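(* Let $\Lambda=(\lambda_n)_{n\in\mathbb{N}^*}$ be a sequence of positive real numbers, ultimately strictly increasing and tending to $+\infty$, with $b(\Lambda)<+\infty$. If there exists a positive number $\ell$ such that $$\sum_{k}\left|\frac{1}{\lambda_k}-\frac{\ell}{k}\right|<\infty,$$ then $\ell=b(\Lambda)$.
   Context: $\mathbb{N}^*=\{1,2,3,\dots\}$. For a sequence $\Lambda=(\lambda_n)_{n\in\mathbb{N}^*}$ of positive real numbers, ultimately strictly increasing, with $\lambda_n\to+\infty$, the Beurling-Malliavin density $b(\Lambda)\in[0,+\infty]$ is the infimum of the numbers $a\ge 0$ for which there exists a sequence $(n_k)_{k\in\mathbb{N}^*}$ of distinct positive integers such that $\sum_{k=1}^\infty\left|\frac{1}{\lambda_k}-\frac{a}{n_k}\right|<\infty$; if no such $a$ exists, $b(\Lambda)=+\infty$. *)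

(* Defs.v *)
From HB Require Import structures.
From mathcomp Require Import all_boot all_order all_algebra.
From mathcomp Require Import all_classical all_reals all_analysis.
Set Implicit Arguments.
Unset Strict Implicit.
Unset Printing Implicit Defensive.
Import Order.TTheory GRing.Theory Num.Theory.
Import numFieldNormedType.Exports.
Local Open Scope classical_set_scope.
Local Open Scope ring_scope.

(* Sequences indexed by the positive integers are functions on [nat] whose
   value at 0 is never used: every condition and sum starts at index 1. *)

Definition distinct_posints (n : nat -> nat) : Prop :=
  (forall k, (0 < k)%N -> (0 < n k)%N) /\
  (forall j k, (0 < j)%N -> (0 < k)%N -> n j = n k -> j = k).

Definition ult_strictly_increasing (R : realType) (lambda : nat -> R) : Prop :=
  exists N : nat, forall m k : nat,
    (N <= m)%N -> (m < k)%N -> lambda m < lambda k.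

(* The set is empty exactly when no [a] is admissible, and [ereal_inf set0] is
   [+oo], so the convention for that case is built in. *)
Definition bm_density (R : realType) (lambda : nat -> R) : \bar R :=
  ereal_inf [set a%:E | a in [set a : R | 0 <= a /\
    exists n : nat -> nat, distinct_posints n /\
      (\sum_(1 <= k <oo) `|(lambda k)^-1 - a / (n k)%:R|%:E < +oo)%E]].

(* Main.v *)
Require Import Defs.
From HB Require Import structures.
From mathcomp Require Import all_boot all_order all_algebra.
From mathcomp Require Import all_classical all_reals all_analysis.
Import Order.TTheory GRing.Theory Num.Theory.
Import numFieldNormedType.Exports.
Local Open Scope classical_set_scope.
Local Open Scope ring_scope.

(** The proof compares two harmonic-type sums.  Taking [n k = k] shows that
    [ell] is admissible in the infimum defining the density, so what remains is
    that every admissible [a] satisfies [ell <= a].  If [a] is admissible with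
    distinct positive integers [n k], then by the triangle inequality the series
    of [ell / k - a / n k] converges absolutely.  Among all choices of N distinct
    positive integers, [1, ..., N] has the largest sum of reciprocals
    ([sum_nonincr_uniq_le]), so the partial sums of that series are at least
    [(ell - a) * H_N], with [H_N] the harmonic number; since [H_N] is unbounded
    ([harmonic_sum_unbounded]), [a < ell] is impossible. *)

(** A nonincreasing weight summed over distinct positive integers is largest on
    an initial segment: by pigeonhole one of the [size s] integers is at least
    [size s], so its weight is at most that of [size s], and it can be removed
    for an induction on the size. *)
Lemma sum_nonincr_uniq_le (R : numDomainType) (f : nat -> R) (s : seq nat) :
  (forall i j, (0 < i)%N -> (i <= j)%N -> f j <= f i) ->
  uniq s -> all (fun i => 0 < i)%N s ->
  \sum_(i <- s) f i <= \sum_(1 <= k < (size s).+1) f k.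
Proof.
move=> f_noninc; move sz_s : (size s) => n.
elim: n s sz_s => [|n IHn] s sz_s s_uniq /allP s_gt0.
  by rewrite (size0nil sz_s) [X in _ <= X]big_geq // big_nil.
have /hasP[x xs lt_nx] : has (fun i => n < i)%N s.
  rewrite -[has _ _]negbK -all_predC; apply/negP => /allP le_sn.
  have : {subset s <= iota 1 n}.
    move=> i i_s; rewrite mem_iota add1n ltnS s_gt0 //= leqNgt.
    exact: le_sn.
  by move=> /(uniq_leq_size s_uniq); rewrite size_iota sz_s ltnn.
rewrite (perm_big _ (perm_to_rem xs)) big_cons big_nat_recr //= addrC.
apply: lerD; last exact: f_noninc.
apply: IHn; rewrite ?rem_uniq ?size_rem ?sz_s //.
by apply/allP => i /mem_rem; exact: s_gt0.
Qed.

Lemma harmonic_sum_unbounded (R : realType) (M : R) :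
  exists N, M < \sum_(1 <= k < N.+1) (k%:R)^-1.
Proof.
apply: contrapT => /forallNP H_le; apply: (@dvg_harmonic R).
apply: nondecreasing_is_cvgn.
  by apply/nondecreasing_series => k _ _; exact: harmonic_ge0.
exists M => _ [N _ <-]; have /negP := H_le N.
by rewrite -leNgt big_add1 /series.
Qed.

Lemma nneseries_lty_partial_sum_le (R : realType) (u : nat -> R) m :
  (forall k, 0 <= u k) -> (\sum_(m <= k <oo) (u k)%:E < +oo)%E ->
  exists M : R, forall N, \sum_(m <= k < N) u k <= M.
Proof.
move=> u_ge0 u_lty.
have uE_ge0 k : (m <= k)%N -> xpredT k -> (0 <= (u k)%:E)%E.
  by rewrite lee_fin.
have S_fin : (\sum_(m <= k <oo) (u k)%:E)%E \is a fin_num.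
  by rewrite ge0_fin_numE // nneseries_ge0.
exists (fine (\sum_(m <= k <oo) (u k)%:E)%E) => N.
by rewrite -lee_fin fineK // -sumEFin; exact: nneseries_lim_ge.
Qed.

(** Because the [n k] are distinct, the first N terms [a / n k] sum to at most
    [a] times the N-th harmonic number, whatever the order of the [n k].  The
    terms [ell / k] sum to [ell] times that number, so if [a < ell] the gap
    between the two sums exceeds the bound [M1 + M2] given by the two series. *)
Lemma le_admissible_density (R : realType) (lambda : nat -> R) (ell a : R)
  (n : nat -> nat) :
  0 <= a -> distinct_posints n ->
  (\sum_(1 <= k <oo) `|(lambda k)^-1 - ell / k%:R|%:E < +oo)%E ->
  (\sum_(1 <= k <oo) `|(lambda k)^-1 - a / (n k)%:R|%:E < +oo)%E ->
  ell <= a.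
Proof.
move=> a_ge0 [n_gt0 n_inj].
move=> /nneseries_lty_partial_sum_le[//|M1 leM1].
move=> /nneseries_lty_partial_sum_le[//|M2 leM2].
rewrite leNgt; apply/negP; rewrite -subr_gt0 => lt_a_ell.
have [N] := harmonic_sum_unbounded R ((M1 + M2) / (ell - a)).
rewrite ltr_pdivrMr // ltNge => /negP; apply.
rewrite mulrC; set H := \sum_(_ <= _ < _) _.
have le_nH : \sum_(1 <= k < N.+1) ((n k)%:R : R)^-1 <= H.
  have := @sum_nonincr_uniq_le R (fun i => i%:R^-1) (map n (iota 1 N)).
  rewrite big_map size_map size_iota /H /index_iota subn1; apply.
  - move=> i j i_gt0 le_ij.
    by rewrite lef_pV2 ?posrE ?ltr0n ?ler_nat // (leq_trans i_gt0).
  - rewrite map_inj_in_uniq ?iota_uniq // => i j.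
    by rewrite !mem_iota => /andP[i_gt0 _] /andP[j_gt0 _]; exact: n_inj.
  - apply/allP => _ /mapP[i + ->].
    by rewrite mem_iota => /andP[i_gt0 _]; exact: n_gt0.
apply: le_trans (lerD (leM1 N.+1) (leM2 N.+1)).
apply: (@le_trans _ _ (\sum_(1 <= k < N.+1) (ell / k%:R - a / (n k)%:R))).
  by rewrite sumrB -!mulr_sumr mulrBl lerB // ler_wpM2l.
rewrite -big_split /=; apply: ler_sum => k _.
apply: le_trans (ler_norm _) _.
by apply: le_trans (ler_distD (lambda k)^-1 _ _) _; rewrite [X in X + _]distrC.
Qed.

Theorem corollary6p2 (R : realType) (lambda : nat -> R)
  (lambda_gt0 : forall k : nat, (0 < k)%N -> 0 < lambda k)
  (lambda_incr : ult_strictly_increasing lambda)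
  (lambda_infty : lambda k @[k --> \oo] --> +oo)
  (b_fin : (bm_density lambda < +oo)%E)
  (ell : R) (ell_gt0 : 0 < ell)
  (Hell : (\sum_(1 <= k <oo) `|(lambda k)^-1 - ell / k%:R|%:E < +oo)%E) :
  ell%:E = bm_density lambda.
Proof.
apply/eqP; rewrite eq_le; apply/andP; split.
  apply: le_ereal_inf_tmp => _ [a [a_ge0 [n [n_posint Ha]]] <-].
  by rewrite lee_fin; exact: le_admissible_density n_posint Hell Ha.
apply: ereal_inf_lbound; exists ell => //; split; first exact: ltW.
by exists id.
Qed.
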